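(* For an arbitrary positive integer $n$ the inverse semigroup $\mathscr{IPF}(\mathbb{N}^n)$ is $E$-unitary.
   Context: $\mathbb{N}$ is the set of positive integers; $(\mathbb{N}^n,\leqslant)$ carries the product (coordinatewise) order; ${\uparrow}\mathbf{x}=\{\mathbf{y}\in\mathbb{N}^n:\mathbf{x}\leqslant\mathbf{y}\}$ is the principal filter generated by $\mathbf{x}$. $\mathscr{IPF}(\mathbb{N}^n)$ is the semigroup of all order isomorphisms between principal filters of $(\mathbb{N}^n,\leqslant)$, with composition of partial maps (maps written on the right, composed left to right, $z(\alpha\beta)=(z\alpha)\beta$ wherever defined). $E(S)$ denotes the set of idempotents of $S$. An inverse semigroup $S$ is $E$-unitary if $ae\in E(S)$ for some $e\in E(S)$ implies $a\in E(S)$. *)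

(* Defs.v *)
From HB Require Import structures.
From mathcomp Require Import all_boot all_order.
From mathcomp Require Import boolp classical_sets.

Set Implicit Arguments.
Unset Strict Implicit.
Unset Printing Implicit Defensive.

Import Order.TTheory.
Local Open Scope classical_set_scope.
Local Open Scope group_scope.

Section SemigroupNotions.
Variable S : semigroupType.

Definition idempotents : set S := [set e | e * e = e].

Definition inverse_semigroup : Prop :=
  forall a : S, exists! b : S, a * b * a = a /\ b * a * b = b.

(* Intended for inverse semigroups: inverse_semigroup S is not part of the
   definition. *)
Definition E_unitary : Prop :=
  forall a : S, (exists2 e, idempotents e & idempotents (a * e)) ->
    idempotents a.

End SemigroupNotions.

Record posnat : Type := Posnat { posnat_val : nat; _ : (0 < posnat_val)%N }.
HB.instance Definition _ := [isSub for posnat_val].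
HB.instance Definition _ := [Choice of posnat by <:].
HB.instance Definition _ :=
  [SubChoice_isSubOrder of posnat by <: with Order.NatOrder.nat_display].

(* MathComp has several orders on n.-tuple; n.-tupleprod selects the
   coordinatewise one. *)
Notation Npow n := (n.-tupleprod posnat).

Section PartialMaps.
Context {d : Order.disp_t} {T : porderType d}.
Implicit Types (f g : T -> option T) (A B : set T).

Definition principal_filter (x : T) : set T := [set y | (x <= y)%O].

Definition pdom f : set T := [set x | exists y, f x = Some y].
Definition pran f : set T := [set y | exists x, f x = Some y].

(* Injectivity of f follows from the last clause by antisymmetry. *)
Definition order_iso_between A B f : Prop :=
  [/\ pdom f = A, pran f = B &
      forall x1 x2 y1 y2, f x1 = Some y1 -> f x2 = Some y2 ->
        (x1 <= x2)%O = (y1 <= y2)%O].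

Definition filter_iso f : Prop :=
  exists a b, order_iso_between (principal_filter a) (principal_filter b) f.

(* Left-to-right composition: first f, then g. *)
Definition pcompose f g : T -> option T := fun x => obind g (f x).

End PartialMaps.

Lemma pcomposeA d (T : porderType d) : associative (@pcompose d T).
Proof.
by move=> f g h; apply/funext => x; rewrite /pcompose; case: (f x).
Qed.

Lemma filter_iso_pcompose d (T : latticeType d) (f g : T -> option T) :
  filter_iso f -> filter_iso g -> filter_iso (pcompose f g).
Proof.
move=> [a [b [domf ranf lef]]] [c [e [domg rang leg]]].
have bc : pran f (b `|` c)%O by rewrite ranf; exact: leUl.
have [p fp] := bc.
have gc : pdom g (b `|` c)%O by rewrite domg; exact: leUr.
have [q gq] := gc.
exists p, q; split.
- apply/seteqP; split=> x.
  + move=> [z]; rewrite /pcompose; case fx: (f x) => [y|] //= gy.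
    have /= by' : principal_filter b y by rewrite -ranf; exists x.
    have /= cy : principal_filter c y by rewrite -domg; exists z.
    by rewrite /principal_filter /= (lef _ _ _ _ fp fx) leUx by' cy.
  + move=> /= px.
    have /= ap : principal_filter a p by rewrite -domf; exists (b `|` c)%O.
    have [y fx] : pdom f x by rewrite domf; exact: le_trans px.
    have [z gy] : pdom g y.
      rewrite domg; apply: (@le_trans _ _ (b `|` c)%O); first exact: leUr.
      by rewrite -(lef _ _ _ _ fp fx).
    by exists z; rewrite /pcompose fx.
- apply/seteqP; split=> z.
  + move=> [x]; rewrite /pcompose; case fx: (f x) => [y|] //= gy.
    have /= by' : principal_filter b y by rewrite -ranf; exists x.
    have /= cy : principal_filter c y by rewrite -domg; exists z.
    by rewrite /principal_filter /= -(leg _ _ _ _ gq gy) leUx by' cy.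
  + move=> /= qz.
    have /= eq' : principal_filter e q by rewrite -rang; exists (b `|` c)%O.
    have [y gy] : pran g z by rewrite rang; exact: le_trans qz.
    have [x fx] : pran f y.
      rewrite ranf; apply: (@le_trans _ _ (b `|` c)%O); first exact: leUl.
      by rewrite (leg _ _ _ _ gq gy).
    by exists x; rewrite /pcompose fx.
- move=> x1 x2 z1 z2; rewrite /pcompose.
  case fx1: (f x1) => [y1|] //= gy1; case fx2: (f x2) => [y2|] //= gy2.
  by rewrite (lef _ _ _ _ fx1 fx2) (leg _ _ _ _ gy1 gy2).
Qed.

Record IPF (n : nat) : Type := MkIPF {
  IPF_fun : Npow n -> option (Npow n);
  _ : `[< filter_iso IPF_fun >]
}.
HB.instance Definition _ n := [isSub for @IPF_fun n].
HB.instance Definition _ n := [Choice of IPF n by <:].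

Lemma IPF_mul_subproof n (f g : IPF n) :
  `[< filter_iso (pcompose (val f) (val g)) >].
Proof.
by apply/asboolP/filter_iso_pcompose; apply/asboolP;
  [exact: valP f | exact: valP g].
Qed.

Definition IPF_mul n (f g : IPF n) : IPF n :=
  MkIPF (IPF_mul_subproof f g).

Lemma IPF_mulA n : associative (@IPF_mul n).
Proof. by move=> f g h; apply/val_inj; exact: pcomposeA. Qed.

HB.instance Definition _ n := isSemigroup.Build (IPF n) (@IPF_mulA n).

(* Main.v *)
Require Import Defs.
From mathcomp Require Import all_boot all_order.
From mathcomp Require Import boolp classical_sets zify.

(** Inverses in IPF(N^n) are inverses of partial injections.  For E-unitarity,
    idempotents are partial identities, so if [a * e] and [e] are idempotent
    then [a] fixes every point of some principal filter [{x | p <= x}].  This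
    filter can be enlarged one step down at a time until it is the whole domain
    of [a]: if [q] is obtained from [p] by lowering coordinate [i] by one, the
    interval [[q, p + e_i]] is a three-element chain, and as [a] fixes
    [p] and [p + e_i] this forces the image of [q] to lie below [q]; an image
    lying below the argument, when a cover of the argument is fixed, must be
    the argument itself. *)

Set Implicit Arguments.
Unset Strict Implicit.
Unset Printing Implicit Defensive.

Import Order.TTheory.

(** * Inverses, idempotents and fixed points of partial order isomorphisms *)

Section PartialIsomorphisms.
Context {d : Order.disp_t} {T : porderType d}.
Implicit Types (f g : T -> option T) (A B : set T).

(** A preimage is picked by choice; for injective [f] the choice is immaterial. *)
Definition partial_inverse f (y : T) : option T :=
  match pselect (exists x, f x = Some y) with
  | left h => Some (projT1 (cid h))
  | right _ => None
  end.

Lemma filter_iso_le f : filter_iso f -> forall x1 x2 y1 y2,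
  f x1 = Some y1 -> f x2 = Some y2 -> (x1 <= x2)%O = (y1 <= y2)%O.
Proof. by move=> [a [b []]]. Qed.

Lemma filter_iso_inj f x1 x2 y :
  filter_iso f -> f x1 = Some y -> f x2 = Some y -> x1 = x2.
Proof.
move=> /filter_iso_le le_f f1 f2; apply/le_anti.
by rewrite (le_f _ _ _ _ f1 f2) (le_f _ _ _ _ f2 f1) lexx.
Qed.

Lemma partial_inverseP f x y :
  filter_iso f -> partial_inverse f y = Some x <-> f x = Some y.
Proof.
rewrite /partial_inverse => iso_f; split; case: pselect => // h.
- by case=> <-; case: cid.
- move=> fx; case: cid => x' fx' /=; congr Some; exact: filter_iso_inj fx' fx.
- by move=> fx; case: h; exists x.
Qed.

Lemma partial_inverse_filter_iso f :
  filter_iso f -> filter_iso (partial_inverse f).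
Proof.
move=> iso_f; have [a [b [dom_f ran_f le_f]]] := iso_f.
exists b, a; split.
- by rewrite -ran_f; apply/seteqP; split=> y [x h]; exists x; move: h;
    rewrite partial_inverseP.
- by rewrite -dom_f; apply/seteqP; split=> x [y h]; exists y; move: h;
    rewrite partial_inverseP.
- move=> y1 y2 x1 x2 /(partial_inverseP _ _ iso_f) f1.
  by move=> /(partial_inverseP _ _ iso_f) f2; rewrite (le_f _ _ _ _ f1 f2).
Qed.

Lemma partial_inverse_pcompose f : filter_iso f ->
  pcompose (pcompose f (partial_inverse f)) f = f.
Proof.
move=> iso_f; apply/funext => x; rewrite /pcompose.
case fx: (f x) => [y|] //=.
by move/(partial_inverseP _ _ iso_f): (fx) => -> /=.
Qed.

Lemma pcompose_partial_inverse f : filter_iso f ->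
  pcompose (pcompose (partial_inverse f) f) (partial_inverse f)
  = partial_inverse f.
Proof.
move=> iso_f; apply/funext => y; rewrite /pcompose.
case gy: (partial_inverse f y) => [x|] //=.
by move/(partial_inverseP _ _ iso_f): (gy) => -> /=.
Qed.

(** If [g] sends [y] to [x], then [gfg = g] makes [g] send the image of [x] under [f] to [x] as
    well, and injectivity of [g] identifies that image with [y]. Conversely [fgf = f] forces [g] to
    be defined on the range of [f]. *)
Lemma partial_inverse_unique f g : filter_iso f -> filter_iso g ->
  pcompose (pcompose f g) f = f -> pcompose (pcompose g f) g = g ->
  partial_inverse f = g.
Proof.
move=> iso_f iso_g fgf gfg; apply/funext => y.
case gy: (g y) => [x|].
- apply/partial_inverseP => //.
  have := congr1 (@^~ y) gfg; rewrite /pcompose gy /=.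
  case fx: (f x) => [y'|] //= gy'.
  by rewrite (filter_iso_inj iso_g gy gy').
- case fy: (partial_inverse f y) => [x|] //.
  move/(partial_inverseP _ _ iso_f): fy => fx.
  by have := congr1 (@^~ x) fgf; rewrite /pcompose fx /= gy.
Qed.

Lemma pcompose_idemP f : filter_iso f ->
  pcompose f f = f <-> forall x y, f x = Some y -> y = x.
Proof.
move=> iso_f; split=> [ff x y fx|fid].
- have := congr1 (@^~ x) ff; rewrite /pcompose fx /= => fy.
  exact: filter_iso_inj fy fx.
- apply/funext => x; rewrite /pcompose; case fx: (f x) => [y|] //=.
  by have yx := fid _ _ fx; rewrite yx in fx *.
Qed.

Lemma filter_iso_ran_up f x y z :
  filter_iso f -> f x = Some y -> (y <= z)%O ->
  exists2 v, f v = Some z & (x <= v)%O.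
Proof.
move=> iso_f fx yz; have [a [b [_ ran_f _]]] := iso_f.
have [v fv] : pran f z.
  rewrite ran_f; apply: le_trans yz.
  have : pran f y by exists x.
  by rewrite ran_f.
by exists v => //; rewrite (filter_iso_le iso_f fx fv).
Qed.

(** The range is an up-set containing [y], so [x] is itself the image of some [v]; comparing images
    gives [x <= v <= r]. The case [v = r] would make [r] map to [x], which is strictly below it, so
    [v = x]. *)
Lemma filter_iso_fix_of_cover f x y r :
  filter_iso f -> f x = Some y -> (y <= x)%O -> f r = Some r -> (x < r)%O ->
  (forall v, (x <= v <= r)%O -> v = x \/ v = r) -> y = x.
Proof.
move=> iso_f fx yx fr xr cover_x.
have [v fv xv] := filter_iso_ran_up iso_f fx yx.
have vr : (v <= r)%O by rewrite (filter_iso_le iso_f fv fr) ltW.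
case: (cover_x v) => [|vx|vr']; first by rewrite xv vr.
- by move: fv; rewrite vx fx => -[].
- by move: fv xr; rewrite vr' fr => -[->]; rewrite ltxx.
Qed.

End PartialIsomorphisms.

(** * Coordinates and unit steps in the product order *)

Section Coordinates.
Variable n : nat.
Implicit Types (x y p q : Npow n) (i j : 'I_n).

Definition coord x i : nat := val (tnth x i).

Definition incr_at x i : Npow n :=
  [tuple if j == i then Posnat (ltn0Sn (coord x j)) else tnth x j | j < n].

Lemma coord_gt0 x i : (0 < coord x i)%N.
Proof. exact: (valP (tnth x i)). Qed.

Lemma coord_incr_at x i j : coord (incr_at x i) j = (coord x j + (j == i))%N.
Proof.
by rewrite /coord tnth_mktuple; case: eqP => _ /=; rewrite ?addn1 ?addn0.
Qed.

Lemma leP_coord x y : reflect (forall i, (coord x i <= coord y i)%N) (x <= y)%O.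
Proof. by rewrite Order.TupleProdOrder.leEtprod; apply: forallP. Qed.

Lemma coord_inj x y : coord x =1 coord y -> x = y.
Proof. by move=> xy; apply/eq_from_tnth => i; apply/val_inj/xy. Qed.

Lemma decr_at x i : (1 < coord x i)%N -> exists q, incr_at q i = x.
Proof.
move=> xi.
have pos : (0 < (coord x i).-1)%N by lia.
exists [tuple if j == i then Posnat pos else tnth x j | j < n].
apply/coord_inj => j; rewrite coord_incr_at {1}/coord tnth_mktuple.
by case: eqP => [->|_] /=; [lia | rewrite addn0].
Qed.

Lemma lt_incr_at x i : (x < incr_at x i)%O.
Proof.
rewrite lt_neqAle; apply/andP; split.
- by apply/eqP => /(congr1 (coord^~ i)); rewrite coord_incr_at eqxx; lia.
- by apply/leP_coord => j; rewrite coord_incr_at leq_addr.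
Qed.

Lemma incr_at_cover x v i :
  (x <= v <= incr_at x i)%O -> v = x \/ v = incr_at x i.
Proof.
move=> /andP[/leP_coord xv /leP_coord vx].
have [vi|vi] := eqVneq (coord v i) (coord x i); [left|right];
  apply/coord_inj => j; move: (xv j) (vx j); rewrite ?coord_incr_at;
  case: eqP => [->|_]; lia.
Qed.

End Coordinates.

(** * Enlarging a filter of fixed points to the whole domain *)

Section FixedFilter.
Variables (n : nat) (f : Npow n -> option (Npow n)).
Hypothesis iso_f : filter_iso f.
Implicit Types (x y p q : Npow n) (i j : 'I_n).

Definition fixes_above p := forall x, (p <= x)%O -> f x = Some x.

Lemma fixes_above_decr_at q i : pdom f q -> fixes_above (incr_at q i) ->
  fixes_above q.
Proof.
move=> [q' fq] fix_p; set p := incr_at q i in fix_p.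
have fp : f p = Some p by exact: fix_p.
have q'_lt_p : (q' < p)%O.
  rewrite lt_neqAle -(filter_iso_le iso_f fq fp) (ltW (lt_incr_at q i)) andbT.
  apply/eqP => q'p; rewrite q'p in fq.
  by have := lt_incr_at q i; rewrite -/p (filter_iso_inj iso_f fq fp) ltxx.
have /leP_coord q'_le_p := ltW q'_lt_p.
have q'i : (coord q' i <= coord q i)%N.
  rewrite leqNgt; apply/negP => q'i.
  have fr : f (incr_at p i) = Some (incr_at p i).
    by apply: fix_p; exact: ltW (lt_incr_at p i).
  (* [q' + e_i] lies between [q'] and [p + e_i], so it is the image of a point
     of [{q, p, p + e_i}]; but it is none of [q'], [p], [p + e_i]. *)
  have [v fv qv] := filter_iso_ran_up iso_f fq (ltW (lt_incr_at q' i)).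
  have vr : (v <= incr_at p i)%O.
    rewrite (filter_iso_le iso_f fv fr); apply/leP_coord => j.
    by rewrite (coord_incr_at q') (coord_incr_at p) leq_add2r q'_le_p.
  have vP : v = q \/ (p <= v)%O.
    have [vi|vi] := leqP (coord v i) (coord q i); [left|right].
    + apply/coord_inj => j; move/leP_coord: qv => /(_ j).
      move/leP_coord: vr => /(_ j); rewrite !coord_incr_at.
      by case: eqP => [->|_]; lia.
    + apply/leP_coord => j; move/leP_coord: qv => /(_ j).
      by rewrite coord_incr_at; case: eqP => [->|_]; lia.
  case: vP => [vq|pv].
  + by move: fv (lt_incr_at q' i); rewrite vq fq => -[<-]; rewrite ltxx.
  (* Now [v] is fixed, so [p <= q' + e_i]. As coordinate [i] of [q'] already reaches that of [p],
     this yields [p <= q'], against [q' < p]. *)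
  + move: fv; rewrite fix_p // => -[ve].
    suff pq' : (p <= q')%O by rewrite (le_gtF pq') in q'_lt_p.
    apply/leP_coord => j; move/leP_coord: pv => /(_ j); rewrite ve.
    rewrite coord_incr_at; case: eqP => [->|_]; last by lia.
    by move: q'i; rewrite /p coord_incr_at eqxx; lia.
have {q'i} q'_le_q : (q' <= q)%O.
  apply/leP_coord => j; move: (q'_le_p j); rewrite coord_incr_at.
  by case: eqP => [->|_]; lia.
have q'E : q' = q.
  by apply: (filter_iso_fix_of_cover iso_f fq q'_le_q fp (lt_incr_at q i)) => v;
    exact: incr_at_cover.
rewrite {}q'E in fq => x qx.
have [px|npx] := boolP (p <= x)%O; first exact: fix_p.
(* With [q] fixed, any remaining [x] above [q] but not above [p] agrees with [q] in coordinate [i].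
   Hence [x + e_i] is above [p], so it is a fixed cover of [x]. *)
have xi : coord x i = coord q i.
  apply/eqP; rewrite eqn_leq; move/leP_coord: (qx) => ->; rewrite andbT.
  rewrite leqNgt; apply: contra npx => xi; apply/leP_coord => j.
  move/leP_coord: qx => /(_ j); rewrite coord_incr_at.
  by case: eqP => [->|_]; lia.
have fr : f (incr_at x i) = Some (incr_at x i).
  apply: fix_p; apply/leP_coord => j; rewrite !coord_incr_at leq_add2r.
  exact/leP_coord.
have [y fx] : pdom f x.
  have [a [b [dom_f _ _]]] := iso_f; rewrite dom_f; apply: le_trans qx.
  have : pdom f q by exists q.
  by rewrite dom_f.
have qy : (q <= y)%O by rewrite -(filter_iso_le iso_f fq fx).
have npy : ~~ (p <= y)%O by rewrite -(filter_iso_le iso_f fp fx).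
have yr : (y <= incr_at x i)%O.
  by rewrite -(filter_iso_le iso_f fx fr) ltW // lt_incr_at.
rewrite fx; congr Some.
apply: (filter_iso_fix_of_cover iso_f fx _ fr (lt_incr_at x i)); last first.
  by move=> v; exact: incr_at_cover.
(* Otherwise [y], being above [q], would be above [p]; but [p] is fixed and not below [x]. With
   [y <= x + e_i] this gives [y <= x]. *)
have yi : (coord y i <= coord x i)%N.
  rewrite leqNgt xi; apply: contra npy => yi; apply/leP_coord => j.
  move/leP_coord: qy => /(_ j); rewrite coord_incr_at.
  by case: eqP => [->|_]; lia.
apply/leP_coord => j; move/leP_coord: yr => /(_ j); rewrite coord_incr_at.
by case: eqP => [->|_]; lia.
Qed.

Lemma fixes_above_pdom p : fixes_above p -> forall x, pdom f x -> f x = Some x.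
Proof.
have [a [b [dom_f _ _]]] := iso_f.
(* Descent to the generator [a] of the domain, by induction on a bound for the coordinate sum of
   [p]. *)
suff fix_a k : forall p, (\sum_i coord p i < k)%N -> (a <= p)%O ->
    fixes_above p -> fixes_above a.
  move=> fix_p; have ap : (a <= p)%O.
    have : pdom f p by exists p; exact: fix_p.
    by rewrite dom_f.
  by move=> x; rewrite dom_f; exact: (fix_a _ p (ltnSn _)).
elim: k => // k IHk {}p pk ap fix_p.
have [->//|a_neq_p] := eqVneq a p.
have [i ai] : exists i, (coord a i < coord p i)%N.
  apply/existsP; rewrite -[[exists _, _]]negbK negb_exists.
  apply: contra a_neq_p => /forallP pa; apply/eqP/le_anti; rewrite ap /=.
  by apply/leP_coord => i; rewrite leqNgt.
(* Coordinate [i] of [p] exceeds that of [a], which is at least 1, so lowering it stays among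
   positive integers and above [a]. *)
have [|q pE] := @decr_at _ p i; first by have := coord_gt0 a i; lia.
have aq : (a <= q)%O.
  apply/leP_coord => j; move/leP_coord: ap => /(_ j); move: ai.
  by rewrite -pE !coord_incr_at; case: (j =P i) => [->|_]; rewrite ?eqxx; lia.
apply: (IHk q) => //.
- move: pk; rewrite -pE (eq_bigr _ (fun j _ => coord_incr_at q i j)).
  rewrite big_split /=.
  by rewrite [X in (_ + X)%N](bigD1 i) //= eqxx; lia.
- by apply: (@fixes_above_decr_at q i); rewrite ?pE // dom_f.
Qed.

End FixedFilter.

(** * Transfer to the semigroup *)

Lemma IPF_filter_iso n (a : IPF n) : filter_iso (val a).
Proof. by apply/asboolP; exact: valP a. Qed.

Lemma IPF_idempotentP n (a : IPF n) :
  idempotents a <-> forall x y, val a x = Some y -> y = x.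
Proof.
rewrite -(pcompose_idemP (IPF_filter_iso a)).
by split=> [/(congr1 val)//|aa]; apply/val_inj.
Qed.

Lemma IPF_inverse_semigroup n : inverse_semigroup (IPF n).
Proof.
move=> a; have iso_a := IPF_filter_iso a.
have inv_a : `[< filter_iso (partial_inverse (val a)) >].
  exact/asboolP/partial_inverse_filter_iso.
exists (MkIPF inv_a); split.
- split; apply/val_inj; first exact: partial_inverse_pcompose.
  exact: pcompose_partial_inverse.
- move=> b [/(congr1 val) aba /(congr1 val) bab]; apply/val_inj.
  exact: (partial_inverse_unique iso_a (IPF_filter_iso b) aba bab).
Qed.

Lemma IPF_E_unitary n : E_unitary (IPF n).
Proof.
move=> a [e /IPF_idempotentP id_e /IPF_idempotentP id_ae].
(* The starting filter is the domain of [a * e]: there [a] followed by [e] is the identity, and [e]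
   moves no point, so [a] alone fixes every point. *)
have [p [_ [dom_ae _ _]]] := IPF_filter_iso (a * e)%g.
have fix_p : fixes_above (val a) p.
  move=> x px; have [y aex] : pdom (val (a * e)%g) x by rewrite dom_ae.
  have yx := id_ae _ _ aex; move: aex; rewrite {}yx /= /pcompose.
  by case: (IPF_fun a x) => [z|] //= /id_e ->.
apply/IPF_idempotentP => x y ax.
have := fixes_above_pdom (IPF_filter_iso a) fix_p (ex_intro _ y ax).
by rewrite ax => -[].
Qed.

Theorem corollary2p24 (n : nat) (hn : (0 < n)%N) :
  inverse_semigroup (IPF n) /\ E_unitary (IPF n).
Proof. by split; [exact: IPF_inverse_semigroup | exact: IPF_E_unitary]. Qed.
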